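(* Let $p\in(0,1)$ be fixed, let $H$ be a fixed graph with $k\ge1$ edges and $l$ vertices, and for each $n$ let $G(n,p)$ be the Erdős–Rényi random graph. Let $Y$ be the centered number of subgraphs of $G(n,p)$ isomorphic to $H$, that is, $Y:=\sum_{\alpha}(I_\alpha-\mathbb{E}I_\alpha)$, where the sum runs over all subgraphs $G_\alpha$ of the complete graph $K_n$ that are isomorphic to $H$ and $I_\alpha$ is the indicator that $G_\alpha$ is a subgraph of $G(n,p)$. Let $Z:=Y/\sqrt{\mathbb{V}(Y)}$ and let $N$ be a standard normally distributed random variable. Then for every even $m$ there is a constant $C_1(m,l,k)$, not depending on $n$, such that for all sufficiently large $n$ $$\bigl|\mathbb{E}(Z^m)-\mathbb{E}(N^m)\bigr|\le C_1(m,l,k)\,\frac1{n^2}.$$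
   Context: $G(n,p)$ has vertex set $\{1,\dots,n\}$, and each pair of distinct vertices is joined by an edge with probability $p$, independently of all other pairs. $\mathbb{V}$ denotes variance. The constant may depend on the fixed value of $p$. *)

(* Defs.v *)
From HB Require Import structures.
From mathcomp Require Import all_boot all_order all_algebra.
From mathcomp Require Import all_classical all_reals all_analysis.

Set Implicit Arguments.
Unset Strict Implicit.
Unset Printing Implicit Defensive.

Import Order.TTheory GRing.Theory Num.Theory.
Local Open Scope ring_scope.

(* The unordered pairs of distinct vertices, i.e. the edges of the complete
   graph on V. *)
Definition all_pairs (V : finType) : {set {set V}} :=
  [set e : {set V} | #|e| == 2%N]%SET.

(* A finite simple graph with vertex set (all of) V. *)
Record sgraph (V : finType) := SGraph {
  edges : {set {set V}};
  edges_pairs : edges \subset all_pairs V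
}.

Definition complete_graph (V : finType) : sgraph V :=
  SGraph (subxx (all_pairs V)).

(* A subgraph is a pair (vertex set, edge set). The vertex set has to be
   recorded because H may have isolated vertices. *)
Definition is_subgraph (V : finType) (A : {set V} * {set {set V}})
    (G : sgraph V) : bool :=
  (A.2 \subset edges G) && [forall e in A.2, e \subset A.1].

Definition isomorphic_to (U V : finType) (H : sgraph U)
    (A : {set V} * {set {set V}}) : bool :=
  [exists f : {ffun U -> V},
    [&& injectiveb f,
        A.1 == (f @: [set: U])%SET
      & A.2 == [set f @: (e : {set U}) | e in edges H]%SET]].

(* G is a G(n,p) random graph defined on the probability space (T, P); the last
   clause is the mutual independence of the edge events. *)
Definition erdos_renyi (R : realType) (d : measure_display)
    (T : measurableType d) (P : probability T R) (n : nat) (p : R)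
    (G : T -> sgraph 'I_n) : Prop :=
  let edge_event (e : {set 'I_n}) : set T :=
    [set w | e \in edges (G w)]%classic in
  [/\ forall e, e \in all_pairs 'I_n -> measurable (edge_event e),
      forall e, e \in all_pairs 'I_n -> P (edge_event e) = p%:E
    & forall B : {set {set 'I_n}}, B \subset all_pairs 'I_n ->
        P (\bigcap_(e in [set` B]) edge_event e)%classic
        = (\prod_(e in B) P (edge_event e))%E].

Section subgraph_count.
Context (R : realType) (d : measure_display) (T : measurableType d)
  (P : probability T R) (U : finType) (H : sgraph U) (n : nat)
  (G : T -> sgraph 'I_n).

Definition subgraph_indicator (A : {set 'I_n} * {set {set 'I_n}}) (w : T) : R :=
  (is_subgraph A (G w))%:R.

Definition centered_count (w : T) : R :=
  \sum_(A : {set 'I_n} * {set {set 'I_n}}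
          | is_subgraph A (complete_graph 'I_n) && isomorphic_to H A)
    (subgraph_indicator A w - fine ('E_P[subgraph_indicator A])%E).

Definition normalized_count (w : T) : R :=
  centered_count w / Num.sqrt (fine ('V_P[centered_count])%E).

End subgraph_count.

Definition standard_normal (R : realType) (d : measure_display)
    (T : measurableType d) (P : probability T R) (N : {RV P >-> R}) : Prop :=
  forall A : set R, measurable A -> distribution P N A = normal_prob 0 1 A.

(* Main.v *)
Require Import Defs.
From HB Require Import structures.
From mathcomp Require Import all_boot all_order all_algebra.
From mathcomp Require Import all_classical all_reals all_analysis.
From mathcomp Require Import measurable_realfun fintype finset zify ring lra.

Set Implicit Arguments.
Unset Strict Implicit.
Unset Printing Implicit Defensive.

Import Order.TTheory GRing.Theory Num.Theory.
Import numFieldNormedType.Exports.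
Local Open Scope ring_scope.

(* Expand E[Y^m] = \sum_t E[J_t], where t runs over the m-tuples of copies of H and
   J_t is the product of the centered indicators of the entries of t. By independence
   the recursion E[Y^(m+2)] ~ (m+1) V(Y) E[Y^m], which Gaussian moments satisfy exactly,
   can only fail on tuples in which no entry is edge-disjoint from all others and the
   first entry lies in a component of size at least 3 of the overlap graph. For even m
   such a tuple has at most m/2 components, so choosing one free copy (at most n^l
   ways) per component and overlapping copies (O(n^(l-2)) ways) for the other entries
   shows that there are O(n^((m+2)(l-1) - 2)) of them. Since V(Y) is at least of order
   n^(2l-2), the normalized recursion has error O(n^-2), and the claim follows by
   induction on m. *)

(** * Orderings of tuples along overlaps *)

(* Permutation goals become linear equations between the [count]s of an arbitrary predicate. *)
Ltac perm_by_count2 H H' :=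
  let a := fresh in apply/permP => a;
  have /permP/(_ a) := H; have /permP/(_ a) := H';
  rewrite /= ?count_cat /= ?count_cat /=; clear; lia.

Ltac perm_by_count H := perm_by_count2 H H.

Section LinkedOrderings.
Context (X : eqType) (adj : rel X).
Hypothesis adjC : symmetric adj.

(* The other [size t - linked t] entries overlap no later entry; when tuples are counted
   from the last entry to the first, only these range over all copies. *)
Fixpoint linked (t : seq X) : nat :=
  if t is x :: t' then (has (adj x) t' + linked t')%N else 0%N.

(** Quantifying over [perm_eq] removes a single occurrence, so a repeated entry may overlap its own
    other occurrence. *)
Definition no_isolated (t : seq X) :=
  forall y r, perm_eq t (y :: r) -> has (adj y) r.

(** Fewer than half of the entries are free of overlaps with later ones; at size [2h+2] this forces
    at least [h+2] linked entries. *)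
Definition well_linked (t : seq X) := (size t < (linked t).*2)%N.

(** Entries of [rest] are prepended to [L] so that [2 * linked - size] never decreases. An entry
    overlapping [L] raises it by one. If there is none, an entry and an overlap partner of it, both
    from [rest], are prepended together: two entries with at least one new link. *)
Lemma extend_well_linked (L rest : seq X) :
  no_isolated (L ++ rest) -> well_linked L ->
  exists2 t, perm_eq t (L ++ rest) & well_linked t.
Proof.
have [k] := ubnP (size rest); elim: k L rest => // k IH L rest; rewrite ltnS.
move=> sz iso wl.
have [/hasP[v vr vL]|noL] := boolP (has (fun v => has (adj v) L) rest).
  have pr := perm_to_rem vr.
  have pLr : perm_eq (L ++ rest) ((v :: L) ++ rem v rest).
    by perm_by_count pr.
  have [|y r yr||t tp tw] := IH (v :: L) (rem v rest).
  - by move: sz; rewrite (perm_size pr)/=; lia.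
  - by apply: iso; apply: perm_trans yr.
  - by move: wl; rewrite /well_linked /= vL; lia.
  - by exists t => //; rewrite (perm_trans tp)// perm_sym.
case: rest sz iso noL => [|v r] sz iso noL.
  by exists L => //; rewrite cats0.
have : has (adj v) (L ++ r) by apply: iso; perm_by_count (perm_refl r).
rewrite has_cat => /orP[vL|/hasP[w wr vw]].
  by move: noL; rewrite /= vL.
have pr := perm_to_rem wr.
have pLr : perm_eq (L ++ v :: r) ((w :: v :: L) ++ rem w r).
  by perm_by_count pr.
have [|y q yq||t tp tw] := IH (w :: v :: L) (rem w r).
- by move: sz; rewrite /= (perm_size pr)/=; lia.
- by apply: iso; apply: perm_trans yq.
- by move: wl; rewrite /well_linked /= adjC vw/=; lia.
- by exists t => //; rewrite (perm_trans tp)// perm_sym.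
Qed.

End LinkedOrderings.

(** * Sums over the choice of one entry of a tuple *)

Section Picks.
Context (V : nmodType) (X : eqType).

(** Entries are picked by position, the others keeping their order, so equal entries contribute
    separately, as in Gaussian integration by parts. *)
Fixpoint pick_sum (h : X -> seq X -> V) (s : seq X) : V :=
  if s is y :: s' then h y s' + pick_sum (fun z r => h z (y :: r)) s' else 0.

Lemma pick_sum_eq0 h s :
  (forall z r, perm_eq s (z :: r) -> h z r = 0) -> pick_sum h s = 0.
Proof.
elim: s h => //= y s IH h h0; rewrite h0// add0r; apply: IH => z r zr.
by apply: h0; perm_by_count zr.
Qed.

Lemma pick_sum_cat h s1 y s2 :
  (forall z r r', perm_eq r r' -> h z r = h z r') ->
  pick_sum h (s1 ++ y :: s2) =
  h y (s1 ++ s2) + pick_sum (fun z r => h z (y :: r)) (s1 ++ s2).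
Proof.
elim: s1 h => //= x s1 IH h hp; rewrite IH; last first.
  by move=> z r r' rr'; apply: hp; rewrite perm_cons.
rewrite addrCA; congr (_ + (_ + _)); first by apply: hp; perm_by_count (perm_refl s1).
have: forall s h1 h2, (forall z r, h1 z r = h2 z r) -> pick_sum h1 s = pick_sum h2 s.
  by elim=> //= a s IHs h1 h2 e; rewrite e (IHs _ (fun z r => h2 z (a :: r))).
by apply=> z r; apply: hp; perm_by_count (perm_refl r).
Qed.

End Picks.

Lemma pick_sum_norm (R : numDomainType) (X : eqType) (h : X -> seq X -> R) (s : seq X) (c : R) :
  (forall z r, (size r).+1 = size s -> `|h z r| <= c) ->
  `|pick_sum h s| <= c *+ size s.
Proof.
elim: s h => [|y s IH] h hc /=; first by rewrite normr0.
rewrite mulrS (le_trans (ler_normD _ _))// lerD ?hc//.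
by apply: IH => z r e; apply: hc => /=; rewrite e.
Qed.

(** Every rearrangement of [s] is read off from a permutation of its index list, and the indices are
    distinct. *)
Lemma size_permutations_le (X : eqType) (s : seq X) : (size (permutations s) <= (size s)`!)%N.
Proof.
case: s => [|x0 s0] //; set s := x0 :: s0.
rewrite -[in leqRHS](size_iota 0 (size s)) -size_permutations ?iota_uniq//.
rewrite -(size_map (fun p => [seq nth x0 s i | i <- p])).
apply: uniq_leq_size; first exact: permutations_uniq.
move=> t; rewrite mem_permutations => /(perm_iotaP x0)[p pi ->].
by apply/mapP; exists p; rewrite ?mem_permutations.
Qed.

(** * Tuples of given length, counted with a weight per link *)

Section Sequences.
Context (X : eqType) (Xs : seq X).

Fixpoint seqs (m : nat) : seq (seq X) :=
  if m is m'.+1 then [seq x :: s | x <- Xs, s <- seqs m'] else [:: [::]].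

Lemma mem_seqs m t : (t \in seqs m) = (size t == m) && all (mem Xs) t.
Proof.
elim: m t => [|m IH] t /=; first by case: t.
apply/allpairsP/idP => [[[x s] /= [xX sm ->]]|].
  by move: sm; rewrite IH /= eqSS xX.
case: t => // x t /=; rewrite eqSS => /andP[st /andP[xX tX]].
by exists (x, t); rewrite /= IH st tX.
Qed.

Lemma uniq_seqs m : uniq Xs -> uniq (seqs m).
Proof.
move=> uX; elim: m => //= m IH; apply: allpairs_uniq => //.
by move=> [x s] [y t] _ _ /= [-> ->].
Qed.

Lemma sum_seqsS (V : nmodType) m (F : seq X -> V) :
  \sum_(t <- seqs m.+1) F t = \sum_(x <- Xs) \sum_(s <- seqs m) F (x :: s).
Proof. by rewrite /= big_allpairs_dep. Qed.

(** Each of the [m.+1] positions contributes the same double sum over the picked entry and the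
    remaining tuple. *)
Lemma sum_pick_sum (V : nmodType) m (h : X -> seq X -> V) :
  \sum_(s <- seqs m.+1) pick_sum h s =
  (\sum_(y <- Xs) \sum_(s <- seqs m) h y s) *+ m.+1.
Proof.
elim: m h => [|m IH] h.
  by rewrite sum_seqsS mulr1n; apply: eq_bigr => x _; rewrite !big_seq1 /= addr0.
rewrite sum_seqsS /= mulrS.
under eq_bigr do rewrite big_split/= IH.
rewrite big_split/=; congr (_ + _).
rewrite sumrMnl exchange_big/=; congr (_ *+ _); apply: eq_bigr => y _.
by rewrite big_allpairs_dep.
Qed.

Context (adj : rel X).
Hypothesis adjC : symmetric adj.

(** The weight [w] per linked entry compensates for neighbours of a fixed entry being rarer than
    entries in general by a factor of order [w]. Prepending an entry to [s] therefore costs at most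
    [A + size s * B], whether it is free or linked. *)
Lemma sum_linked_le (w A B m : nat) :
  (size Xs <= A)%N -> {in Xs, forall y, count (adj y) Xs * w <= B}%N ->
  (\sum_(t <- seqs m) w ^ linked adj t <= (A + m * B) ^ m)%N.
Proof.
move=> hA hB; elim: m => [|m IH]; first by rewrite big_seq1.
rewrite /= big_allpairs_dep exchange_big/= expnS.
apply: (@leq_trans (\sum_(s <- seqs m) (A + m.+1 * B) * w ^ linked adj s)%N); last first.
  rewrite -big_distrr leq_mul2l (leq_trans IH) ?orbT//.
  by case: m {IH} => // m; rewrite leq_exp2r// leq_add2l leq_mul2r leqnSn orbT.
rewrite big_seq [leqRHS]big_seq; apply: leq_sum => s; rewrite mem_seqs => /andP[/eqP sm sX].
under eq_bigr do rewrite /= expnD.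
rewrite -big_distrl leq_mul2r; apply/orP; right.
(* Union bound: a free [x] has weight 1, and a linked one is charged to every entry of [s] that it
   overlaps. *)
apply: (@leq_trans (\sum_(x <- Xs) (1 + \sum_(y <- s) adj y x * w))%N).
  apply: leq_sum => x _; have [/hasP[y ys xy]|_] := boolP (has (adj x) s); last by rewrite leq_addr.
  by rewrite expn1 (big_rem y ys)/= (adjC y x) xy mul1n; lia.
rewrite big_split/= sum1_size leq_add// exchange_big/=.
apply: (@leq_trans (size s * B)); last by rewrite sm leq_mul2r leqnSn orbT.
elim: s {sm} sX => [|y s IHs] /=; first by rewrite big_nil.
move=> /andP[yX /IHs sX].
rewrite big_cons mulSn leq_add// -big_distrl/=; apply: leq_trans (hB y yX).
by rewrite -sum1_count [in leqRHS]big_mkcond.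
Qed.

(** A Markov-type bound: a well-linked tuple has weight at least [w ^ h.+2] in the preceding sum. A
    tuple with a well-linked rearrangement is itself a rearrangement of a well-linked tuple, which
    costs the factorial. *)
Lemma count_well_linked (w A B h : nat) :
  uniq Xs -> (size Xs <= A)%N -> {in Xs, forall y, count (adj y) Xs * w <= B}%N -> (0 < w)%N ->
  (count (fun t => has (well_linked adj) (permutations t)) (seqs h.*2.+2) * w ^ h.+2
    <= (h.*2.+2)`! * (A + h.*2.+2 * B) ^ h.*2.+2)%N.
Proof.
move=> uX hA hB w0; set m := h.*2.+2.
pose good := [seq t <- seqs m | well_linked adj t].
have goodle : (size good * w ^ h.+2 <= (A + m * B) ^ m)%N.
  apply: (leq_trans _ (sum_linked_le m hA hB)).
  rewrite -sum1_size big_distrl big_filter big_mkcond.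
  rewrite big_seq [leqRHS]big_seq; apply: leq_sum => t; rewrite mem_seqs => /andP[/eqP st _].
  case: ifPn => //; rewrite /well_linked st /= ?mul1n => ht.
  by rewrite leq_pexp2l//; move: ht; rewrite /m; lia.
rewrite -size_filter.
set bad := [seq t <- _ | _].
have bad_le : (size bad <= m`! * size good)%N.
  apply: (@leq_trans (size (flatten [seq permutations t | t <- good]))).
    apply: uniq_leq_size; first exact/filter_uniq/uniq_seqs.
    move=> t; rewrite mem_filter => /andP[/hasP[t']]; rewrite mem_permutations => tt' wl tm.
    apply/flatten_mapP; exists t'; last by rewrite mem_permutations perm_sym.
    rewrite mem_filter wl; move: tm; rewrite !mem_seqs (perm_size tt').
    by rewrite (perm_all _ tt').
  rewrite size_flatten /shape sumnE big_map big_map.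
  rewrite -sum1_size big_distrr/= big_seq [leqRHS]big_seq; apply: leq_sum => t.
  rewrite mem_filter mem_seqs muln1 => /andP[_ /andP[/eqP st _]].
  by rewrite -st size_permutations_le.
by rewrite (leq_trans (leq_mul bad_le (leqnn _)))// -mulnA leq_mul2l goodle orbT.
Qed.

End Sequences.

(** * Moments of products of centered indicators *)

Section CenteredMoments.
Context (R : realFieldType) (E : finType) (X : eqType) (ed : X -> {set E}) (p : R).
Hypotheses (p0 : 0 < p) (p1 : p < 1).

(* The expectation of X_B * \prod_(x <- t) (X_(ed x) - p^#|ed x|), where X_B is the
   product of independent Bernoulli(p) variables over B. *)
Fixpoint mom (t : seq X) (B : {set E}) : R :=
  if t is x :: t' then mom t' (B :|: ed x) - p ^+ #|ed x| * mom t' B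
  else p ^+ #|B|.

Definition overlap (x y : X) := ~~ [disjoint ed x & ed y].

Lemma overlapC : symmetric overlap.
Proof. by move=> x y; rewrite /overlap disjoint_sym. Qed.

Definition cov (x y : X) : R := mom [:: x; y] set0.

Lemma pow_le1 (n : nat) : p ^+ n <= 1.
Proof. by rewrite exprn_ile1// ltW. Qed.

Lemma mom_norm t B : `|mom t B| <= 2 ^+ size t.
Proof.
elim: t B => [|x t IH] B /=.
  by rewrite ger0_norm ?exprn_ge0 ?(ltW p0)// pow_le1.
rewrite (le_trans (ler_normB _ _))// exprS mulr_natl mulr2n lerD//.
rewrite normrM ger0_norm ?exprn_ge0 ?(ltW p0)//.
by rewrite (le_trans _ (IH B))// ler_piMl// pow_le1.
Qed.

Lemma mom_swap x y t B : mom (x :: y :: t) B = mom (y :: x :: t) B.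
Proof. by rewrite /= -!setUA (setUC (ed x)); ring. Qed.

Lemma mom_middle x s1 s2 B : mom (s1 ++ x :: s2) B = mom (x :: s1 ++ s2) B.
Proof.
elim: s1 B => [//|y s1 IH] B; rewrite cat_cons -[in RHS]cat1s catA [RHS]mom_swap.
by rewrite /= !IH.
Qed.

Lemma perm_mom t t' B : perm_eq t t' -> mom t B = mom t' B.
Proof.
elim: t t' B => [|x t IH] t' B.
  by rewrite perm_sym => /perm_nilP ->.
move=> tt'; have xt' : x \in t' by rewrite -(perm_mem tt') mem_head.
case/splitPr: xt' tt' => s1 s2 tt'.
have tt : perm_eq t (s1 ++ s2) by perm_by_count tt'.
by rewrite mom_middle /= !(IH _ _ tt).
Qed.

(** Independence in algebraic form. The accumulated sets stay inside the disjoint [A] and [A']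
    throughout the induction, so at its end the exponents of [p] add. *)
Lemma mom_cat t s (A A' B B' : {set E}) :
  [disjoint A & A'] -> B \subset A -> B' \subset A' ->
  all (fun x => ed x \subset A) t -> all (fun x => ed x \subset A') s ->
  mom (t ++ s) (B :|: B') = mom t B * mom s B'.
Proof.
move=> dA; elim: t B => [|x t IH] B BA BA' /=.
  move=> _; elim: s B' BA' => [|y s IH] B' BA' /=.
    rewrite -exprD cardsU (_ : B :&: B' = set0) ?cards0 ?subn0//.
    by apply/eqP; rewrite setI_eq0; exact: disjointW dA.
  move=> /andP[yA sA]; rewrite -setUA !IH// ?subUset ?BA' ?yA//; ring.
move=> /andP[xA tA] sA; rewrite -setUA (setUC B') setUA.
by rewrite !IH// ?subUset ?BA ?xA//; ring.
Qed.

Lemma mom_cat0 t s : all (fun x => ~~ has (overlap x) s) t ->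
  mom (t ++ s) set0 = mom t set0 * mom s set0.
Proof.
move=> /allP dis.
pose A := \bigcup_(x <- t) ed x; pose A' := \bigcup_(y <- s) ed y.
rewrite -[X in mom _ X = _](setU0 set0) (@mom_cat t s A A')// ?sub0set//.
- apply/pred0P => e /=; apply/negP => /andP[].
  have inU u : (e \in \bigcup_(x <- u) ed x) = has (fun x => e \in ed x) u.
    by elim: u => [|x u IH]; rewrite ?big_nil ?big_cons inE// IH.
  rewrite !inU => /hasP[x xt ex] /hasP[y ys ey].
  move: (dis _ xt) => /hasPn/(_ _ ys); rewrite negbK => /pred0P/(_ e)/=.
  by rewrite ex ey.
- by apply/allP => x xt; rewrite /A (big_rem x)//= subsetUl.
- by apply/allP => y ys; rewrite /A' (big_rem y)//= subsetUl.
Qed.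

Lemma mom1 x : mom [:: x] set0 = 0.
Proof. by rewrite /= set0U cards0 expr0 mulr1 subrr. Qed.

(** The isolated entry splits off as an independent factor of mean zero. *)
Lemma mom_isolated t y r : perm_eq t (y :: r) -> ~~ has (overlap y) r ->
  mom t set0 = 0.
Proof.
move=> tyr ny; rewrite (perm_mom _ tyr) -cat1s mom_cat0 ?mom1 ?mul0r//.
by rewrite /= ny.
Qed.

Lemma cov_eq0 x y : ~~ overlap x y -> cov x y = 0.
Proof. by move=> nxy; apply: (@mom_isolated _ x [:: y]); rewrite //= orbF. Qed.

(* The error, on one tuple, of Gaussian integration by parts E[J Y^m] ~ m Cov(J,Y) E[Y^(m-1)]. *)
Definition bracket (x : X) (s : seq X) : R :=
  mom (x :: s) set0 - pick_sum (fun y r => cov x y * mom r set0) s.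

(** The first term vanishes by [mom_isolated]. In the term picking [z], the covariance vanishes if
    [y] is [x] or [z]; otherwise [y] is isolated among the remaining entries. *)
Lemma bracket_isolated x s y r :
  perm_eq (x :: s) (y :: r) -> ~~ has (overlap y) r -> bracket x s = 0.
Proof.
move=> pyr ny; rewrite /bracket (mom_isolated pyr ny) pick_sum_eq0 ?subrr// => z q szq.
have nyq w : w \in r -> ~~ overlap y w by move=> wr; move/hasPn: ny; apply.
have [xy|yx] := eqVneq y x.
  rewrite xy in nyq pyr; rewrite cov_eq0 ?mul0r//; apply: nyq.
  by move: pyr; rewrite perm_cons => /perm_mem <-; rewrite (perm_mem szq) mem_head.
have ys : y \in z :: q.
  rewrite -(perm_mem szq); have := perm_mem pyr y.
  by rewrite !inE eqxx (negbTE yx).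
have pr : perm_eq (y :: r) (x :: z :: q) by perm_by_count2 pyr szq.
move: ys; rewrite inE => /predU1P[yz|yq].
  rewrite cov_eq0 ?mul0r// overlapC -yz; apply: nyq.
  have : x \in y :: r by rewrite (perm_mem pr) mem_head.
  by rewrite inE eq_sym (negbTE yx).
have pq := perm_to_rem yq.
rewrite (mom_isolated pq) ?mulr0//; apply/hasPn => w wq; apply: nyq.
have : perm_eq r (x :: z :: rem y q) by perm_by_count2 pr pq.
by move/perm_mem->; rewrite !inE wq !orbT.
Qed.

(** Only the pick of [y] can survive, since [x] has zero covariance with the rest. By independence
    the moment factors into exactly that term. *)
Lemma bracket_matched x s1 y s2 :
  ~~ has (fun z => overlap z x || overlap z y) (s1 ++ s2) -> bracket x (s1 ++ y :: s2) = 0.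
Proof.
move=> /hasPn nz; rewrite /bracket pick_sum_cat; last first.
  by move=> z r r' rr'; rewrite (perm_mom _ rr').
rewrite pick_sum_eq0 ?addr0; last first.
  move=> z r szr; rewrite cov_eq0 ?mul0r// overlapC.
  have /nz : z \in s1 ++ s2 by rewrite (perm_mem szr) mem_head.
  by rewrite negb_or => /andP[].
have pxy : perm_eq (x :: s1 ++ y :: s2) ([:: x; y] ++ s1 ++ s2) by perm_by_count (perm_refl s1).
rewrite (perm_mom _ pxy) mom_cat0 ?subrr//=.
rewrite andbT; apply/andP; split; apply/hasPn => z /nz;
  by rewrite negb_or overlapC (overlapC z y) => /andP[].
Qed.

(** By the two preceding vanishing results, [x] overlaps some [y], a third entry [z] overlaps [x] or
    [y], and no entry is isolated. *)
Lemma bracket_neq0 x s : bracket x s != 0 ->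
  has (well_linked overlap) (permutations (x :: s)).
Proof.
move=> b0.
have iso : no_isolated overlap (x :: s).
  move=> y r pyr; apply: contraNT b0 => ny.
  by rewrite (bracket_isolated pyr ny).
have /hasP[y ys xy] := iso x s (perm_refl _).
case/splitPr: ys b0 iso => s1 s2 b0 iso.
have /hasP[z zs zxy] : has (fun z => overlap z x || overlap z y) (s1 ++ s2).
  by apply: contraNT b0 => /bracket_matched ->.
have pz := perm_to_rem zs.
have pxy : perm_eq (x :: s1 ++ y :: s2) ([:: z; y; x] ++ rem z (s1 ++ s2)) by perm_by_count pz.
(* The seed has three entries and two links, and [3 < 2 * 2]; a mere overlapping pair would only
   give equality. *)
have [||t tp tw] := @extend_well_linked _ _ overlapC [:: z; y; x] (rem z (s1 ++ s2)).
- by move=> w r wr; apply: iso; exact: perm_trans wr.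
- by rewrite /well_linked /= !orbF (overlapC y x) xy orbC zxy.
apply/hasP; exists t => //; rewrite mem_permutations.
by rewrite (perm_trans tp)// perm_sym.
Qed.

Lemma bracket_norm x s : `|bracket x s| <= 2 ^+ (size s).+1 *+ (size s).+1.
Proof.
rewrite mulrS (le_trans (ler_normB _ _))// lerD//; first exact: mom_norm.
apply: pick_sum_norm => z r <-.
rewrite normrM (exprD 2 2 (size r)) ler_pM ?normr_ge0//; exact: mom_norm.
Qed.

(** * The moment recursion and a lower bound for the variance *)

Section MomentRecursion.
Variable Xs : seq X.

(** This is [E[Y^m]] when [Xs] lists the copies of H; [moment_sum 2] is then the variance of Y. *)
Definition moment_sum (m : nat) : R := \sum_(t <- seqs Xs m) mom t set0.

Lemma moment_sum0 : moment_sum 0 = 1.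
Proof. by rewrite /moment_sum /= big_seq1 /= cards0. Qed.

Lemma moment_sum2 : moment_sum 2 = \sum_(x <- Xs) \sum_(y <- Xs) cov x y.
Proof.
rewrite /moment_sum sum_seqsS; apply: eq_bigr => x _.
by rewrite sum_seqsS; apply: eq_bigr => y _; rewrite big_seq1.
Qed.

Lemma moment_recursion m :
  moment_sum m.+2 - (moment_sum 2 * moment_sum m) *+ m.+1 =
  \sum_(x <- Xs) \sum_(s <- seqs Xs m.+1) bracket x s.
Proof.
rewrite moment_sum2 [in LHS]/moment_sum sum_seqsS.
under [in RHS]eq_bigr do rewrite sumrB sum_pick_sum.
rewrite sumrB; congr (_ - _); rewrite sumrMnl; congr (_ *+ _).
rewrite big_distrl; apply: eq_bigr => x _; rewrite big_distrl; apply: eq_bigr => y _.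
by rewrite big_distrr.
Qed.

(** The number of tuples with nonzero bracket times the uniform bound [bracket_norm]. *)
Lemma moment_recursion_error (w A B h : nat) :
  uniq Xs -> (size Xs <= A)%N -> {in Xs, forall y, count (overlap y) Xs * w <= B}%N -> (0 < w)%N ->
  `|moment_sum h.*2.+2 - (moment_sum 2 * moment_sum h.*2) *+ h.*2.+1| * w%:R ^+ h.+2
  <= ((h.*2.+2)`! * (A + h.*2.+2 * B) ^ h.*2.+2 * (2 ^ h.*2.+2 * h.*2.+2))%:R.
Proof.
move=> uX hA hB w0; rewrite moment_recursion.
have := count_well_linked overlapC h uX hA hB w0.
set m := h.*2.+2; set P := (fun t => _); set bd := (_`! * _)%N => cnt.
pose c : R := (2 ^ m * m)%:R.
have le1 : `|\sum_(x <- Xs) \sum_(s <- seqs Xs h.*2.+1) bracket x s| <= c * (count P (seqs Xs m))%:R.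
  rewrite -sum1_count natr_sum big_distrr [leRHS]big_mkcond (sum_seqsS Xs h.*2.+1).
  apply: le_trans (ler_norm_sum _ _ _) _; apply: ler_sum => x _.
  apply: le_trans (ler_norm_sum _ _ _) _; rewrite big_seq [leRHS]big_seq.
  apply: ler_sum => s; rewrite mem_seqs => /andP[/eqP ss _].
  case: ifPn => [_|nP]; last first.
    rewrite (_ : bracket x s = 0) ?normr0//.
    by apply: contraNeq nP; exact: bracket_neq0.
  rewrite /= mulr1 (le_trans (bracket_norm x s))// ss /c natrM natrX mulr_natr.
  by [].
apply: le_trans (ler_wpM2r _ le1) _; first by rewrite exprn_ge0.
by rewrite -mulrA -natrX -!natrM ler_nat mulnC leq_mul2r cnt orbT.
Qed.

Lemma covE x y : cov x y = p ^+ #|ed x :|: ed y| - p ^+ (#|ed x| + #|ed y|).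
Proof. by rewrite /cov /= !set0U cards0 expr0 exprD; ring. Qed.

(** The quotient [(1 - p^j) / (1 - p)] is a geometric sum of [j] terms, each at least [p^j].
    Linearity in [j] is what allows double counting of common edges later. *)
Lemma one_sub_pow_ge (j : nat) : (1 - p) * j%:R * p ^+ j <= 1 - p ^+ j.
Proof.
elim: j => [|j IH]; first by rewrite mulr0 mul0r expr0 subrr.
have pj : 0 <= p ^+ j by rewrite exprn_ge0// ltW.
have h : 0 <= (1 - p) * j.+1%:R * p ^+ j * (1 - p).
  by rewrite !mulr_ge0// subr_ge0 ltW.
move: IH h; rewrite -[j.+1%:R]natr1 exprS; set q := p ^+ j; set r := j%:R.
by move=> IH h; nra.
Qed.

Lemma cov_ge x y : (1 - p) * p ^+ (#|ed x| + #|ed y|) * #|ed x :&: ed y|%:R <= cov x y.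
Proof.
have e : (#|ed x| + #|ed y| = #|ed x :|: ed y| + #|ed x :&: ed y|)%N.
  by rewrite -cardsUI.
rewrite covE e exprD.
rewrite [leLHS](_ : _ = p ^+ #|ed x :|: ed y| * ((1 - p) * #|ed x :&: ed y|%:R * p ^+ #|ed x :&: ed y|)); last by ring.
rewrite [leRHS](_ : _ = p ^+ #|ed x :|: ed y| * (1 - p ^+ #|ed x :&: ed y|)); last by ring.
by rewrite ler_wpM2l ?exprn_ge0 ?(ltW p0)// one_sub_pow_ge.
Qed.

(** By [cov_ge] the variance dominates the sum of [#|ed x :&: ed y|] over all pairs, which is the
    sum of squared edge degrees. The degrees sum to [k * size Xs] over at most [v] edges. *)
Lemma moment_sum2_ge (D : {set E}) (k v : nat) : (0 < v)%N -> (#|D| <= v)%N ->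
  {in Xs, forall x, ed x \subset D} -> {in Xs, forall x, #|ed x| = k} ->
  (1 - p) * p ^+ k.*2 * (k * size Xs)%:R ^+ 2 <= moment_sum 2 * v%:R.
Proof.
move=> v0 Dv XD Xk.
pose deg (e : E) : R := (count (fun x => e \in ed x) Xs)%:R.
have degE e : deg e = \sum_(x <- Xs) (e \in ed x)%:R.
  by rewrite /deg -sum1_count natr_sum big_mkcond; apply: eq_bigr => x _; case: ifP.
have sumdeg : \sum_(e in D) deg e = (k * size Xs)%:R.
  under eq_bigr do rewrite degE.
  rewrite exchange_big/= -sum1_size big_distrr natr_sum/= big_seq [RHS]big_seq.
  apply: eq_bigr => x xX; rewrite muln1 -(Xk x xX) -sum1_card natr_sum.
  rewrite big_mkcond [RHS]big_mkcond; apply: eq_bigr => e _.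
  by case: ifPn => eD; case: ifPn => // ex; move/subsetP: (XD x xX) => /(_ e ex); rewrite (negbTE eD).
have sumdeg2 : \sum_(x <- Xs) \sum_(y <- Xs) #|ed x :&: ed y|%:R = \sum_(e in D) deg e ^+ 2.
  under [RHS]eq_bigr do rewrite expr2 {1}degE big_distrl/=.
  rewrite [RHS]exchange_big/= big_seq [RHS]big_seq; apply: eq_bigr => x xX.
  under [RHS]eq_bigr do rewrite degE big_distrr/=.
  rewrite [RHS]exchange_big/=; apply: eq_bigr => y _.
  rewrite -sum1_card natr_sum big_mkcond [RHS]big_mkcond; apply: eq_bigr => e _.
  rewrite inE; have [ex|ex] := boolP (e \in ed x); last by rewrite mul0r if_same.
  by rewrite (subsetP (XD x xX) e ex) mul1r; case: (e \in ed y).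
have le1 : (1 - p) * p ^+ k.*2 * \sum_(e in D) deg e ^+ 2 <= moment_sum 2.
  rewrite -sumdeg2 moment_sum2 big_distrr/= big_seq [leRHS]big_seq; apply: ler_sum => x xX.
  rewrite big_distrr/= big_seq [leRHS]big_seq; apply: ler_sum => y yX.
  by apply: le_trans (cov_ge x y); rewrite (Xk _ xX) (Xk _ yX) addnn.
have v0' : 0 < v%:R :> R by rewrite ltr0n.
(* Cauchy-Schwarz for [deg] against the constant function 1 on D *)
have CS : (k * size Xs)%:R ^+ 2 <= (\sum_(e in D) deg e ^+ 2) * v%:R.
  pose a : R := (k * size Xs)%:R / v%:R.
  have : 0 <= \sum_(e in D) (deg e - a) ^+ 2 by apply: sumr_ge0 => e _; exact: sqr_ge0.
  have -> : \sum_(e in D) (deg e - a) ^+ 2 =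
      \sum_(e in D) deg e ^+ 2 - 2 * a * (k * size Xs)%:R + a ^+ 2 * #|D|%:R.
    rewrite -sumdeg big_distrr mulr_natr -sumr_const -sumrN -!big_split/=.
    by apply: eq_bigr => e _; ring.
  have : a ^+ 2 * #|D|%:R <= a ^+ 2 * v%:R by rewrite ler_wpM2l ?sqr_ge0// ler_nat.
  have : (k * size Xs)%:R = a * v%:R by rewrite divfK// gt_eqF.
  move: (\sum_(e in D) _) (#|D|%:R) (k * size Xs)%:R => S q M -> h1 h2.
  have h3 : 0 <= S - a ^+ 2 * v%:R by nra.
  have := mulr_ge0 h3 (ltW v0'); nra.
apply: le_trans (ler_wpM2r (ltW v0') le1).
by rewrite -[leRHS]mulrA ler_wpM2l// mulr_ge0 ?exprn_ge0 ?subr_ge0 ?(ltW p0) ?(ltW p1).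
Qed.

End MomentRecursion.

End CenteredMoments.

(** * From the recursion to normalized moments *)

Section NormalizedMoments.
Context (R : realFieldType) (c : R) (K : nat -> R).
Hypothesis c0 : 0 < c.

(** Accumulates the errors of the recursion: each step multiplies the old error by [2h+1] and adds a
    fresh one. *)
Fixpoint moment_error (h : nat) : R :=
  if h is h'.+1 then K h' / c ^+ h + h'.*2.+1%:R * moment_error h' else 0.

Lemma normalized_moments_close (M : nat -> R) (s n : R) (l : nat) :
  0 < n -> M 0%N = 1 -> c * n ^+ l.*2 <= s * n ^+ 2 ->
  (forall h, `|M h.*2.+2 - (s * M h.*2) *+ h.*2.+1| * (n ^+ 2) ^+ h.+2
     <= K h * n ^+ (l * h.*2.+2)) ->
  forall h, `|M h.*2 / s ^+ h - \prod_(i < h) i.*2.+1%:R| <= moment_error h * (1 / n ^+ 2).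
Proof.
move=> n0 M0 hs hM.
have n2 : 0 < n ^+ 2 by rewrite exprn_gt0.
have s0 : 0 < s by rewrite -(pmulr_lgt0 _ n2) (lt_le_trans _ hs)// mulr_gt0// exprn_gt0.
elim=> [|h IH]; first by rewrite M0 big_ord0 expr0 divr1 subrr normr0 mul0r.
have sh : 0 < s ^+ h by rewrite exprn_gt0.
have sh1 : 0 < s ^+ h.+1 by rewrite exprn_gt0.
have ch1 : 0 < c ^+ h.+1 by rewrite exprn_gt0.
set e := M h.*2.+2 - (s * M h.*2) *+ h.*2.+1.
rewrite big_ord_recr/= doubleS.
(* The Gaussian product satisfies the recursion exactly, so only the new error [e] and the
   propagated old error remain. *)
rewrite (_ : _ - _ = e / s ^+ h.+1 + h.*2.+1%:R * (M h.*2 / s ^+ h - \prod_(i < h) i.*2.+1%:R)); last first.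
  rewrite /e exprS -mulr_natr; field; rewrite !gt_eqF//.
rewrite (le_trans (ler_normD _ _))// [leRHS]mulrDl lerD//; last first.
  by rewrite normrM normr_nat -mulrA ler_wpM2l.
rewrite normrM normfV (ger0_norm (ltW sh1)) ler_pdivrMr//.
rewrite -(ler_pM2r (_ : 0 < (n ^+ 2) ^+ h.+2)) ?exprn_gt0//.
apply: (le_trans (hM h)).
have K0 : 0 <= K h.
  rewrite -(pmulr_lge0 _ (exprn_gt0 (l * h.*2.+2) n0)); apply: le_trans (hM h).
  by rewrite mulr_ge0// exprn_ge0// ltW.
(* Of the [h+2] factors [n^2], the variance bound absorbs [h+1]; the last one is the rate
   [1 / n^2]. *)
have -> : K h / c ^+ h.+1 * (1 / n ^+ 2) * s ^+ h.+1 * (n ^+ 2) ^+ h.+2 =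
    K h * ((s * n ^+ 2) ^+ h.+1 / c ^+ h.+1).
  by rewrite (exprMn h.+1 s (n ^+ 2)) (exprS (n ^+ 2) h.+1); field; rewrite !gt_eqF.
rewrite ler_wpM2l// ler_pdivlMr//.
have -> : n ^+ (l * h.*2.+2) * c ^+ h.+1 = (c * n ^+ l.*2) ^+ h.+1.
  by rewrite exprMn -exprM mulrC -doubleS -!muln2 mulnA mulnAC.
by rewrite lerXn2r// nnegrE mulr_ge0 ?(ltW c0) ?(ltW s0) ?exprn_ge0 ?(ltW n0).
Qed.

End NormalizedMoments.

(** * Counting copies *)

Local Notation subgraph n := ({set 'I_n} * {set {set 'I_n}})%type.

Section CountingCopies.
Local Open Scope nat_scope.

(** Stated as a product so that no exponent [#|U| - 2] has to be subtracted. *)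
Lemma card_ffun_fix2 (U V : finType) (u v : U) (a b : V) : u != v ->
  (#|[set f : {ffun U -> V} | (f u == a) && (f v == b)]| * #|V| ^ 2 = #|V| ^ #|U|)%N.
Proof.
move=> uv.
pose F (x : U) : pred V := if x == u then pred1 a else if x == v then pred1 b else predT.
have -> : #|[set f : {ffun U -> V} | (f u == a) && (f v == b)]| = #|family F|.
  apply: eq_card => f; rewrite !inE; apply/andP/familyP => [[/eqP fu /eqP fv] x|fF].
    rewrite /F; case: eqVneq => [->|xu]; first by rewrite inE fu.
    by case: eqVneq => [->|xv]; rewrite inE// fv.
  have := fF u; have := fF v; rewrite /F eqxx (eq_sym v) (negbTE uv) eqxx !inE.
  by move=> -> ->.
rewrite card_family foldrE big_map big_enum/=.
have -> : #|V| ^ #|U| = \prod_(x : U) #|V| by rewrite prod_nat_const.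
rewrite (bigD1 u)//= (bigD1 v)/=; last by rewrite eq_sym.
rewrite [RHS](bigD1 u)//= [in RHS](bigD1 v)/=; last by rewrite eq_sym.
rewrite /F !eqxx (eq_sym v) (negbTE uv) !card1 !mul1n mulnC -mulnA.
congr (_ * (_ * _)); apply: eq_bigr => x /andP[xu xv]; rewrite (negbTE xu) (negbTE xv).
by apply: eq_card.
Qed.

Section Copies.
Context (U : finType) (H : sgraph U) (n : nat).

Definition graph_image (f : {ffun U -> 'I_n}) : subgraph n :=
  ((f @: [set: U])%SET, [set f @: (e : {set U}) | e in edges H]%SET).

Definition copies : seq (subgraph n) :=
  enum [pred A | is_subgraph A (complete_graph 'I_n) && isomorphic_to H A].

Lemma copies_image A : A \in copies -> exists2 f : {ffun U -> 'I_n}, injective f & A = graph_image f.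
Proof.
rewrite mem_enum inE => /andP[_ /existsP[f /and3P[/injectiveP fi /eqP e1 /eqP e2]]].
by exists f => //; case: A e1 e2 => A1 A2 /= -> ->.
Qed.

Lemma uniq_copies : uniq copies.
Proof. exact: enum_uniq. Qed.

Lemma copies_sub A : A \in copies -> A.2 \subset all_pairs 'I_n.
Proof. by rewrite mem_enum inE => /andP[/andP[]]. Qed.

Lemma copies_card A : A \in copies -> #|A.2| = #|edges H|.
Proof.
by case/copies_image => f fi -> /=; rewrite card_imset//; exact: imset_inj.
Qed.

Lemma size_copies_le : (size copies <= n ^ #|U|)%N.
Proof.
rewrite -[n in n ^ _]card_ord -card_ffun.
rewrite -(size_image graph_image predT); apply: uniq_leq_size; first exact: uniq_copies.
by move=> A /copies_image[f _ ->]; exact: image_f.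
Qed.

(** If the image of [f] has the edge [{a, b}], then [f] sends some two distinct vertices to [a] and
    [b]. There are at most [#|U| ^ 2] such ordered pairs, and each determines two values of [f]. *)
Lemma count_copies_edge (e : {set 'I_n}) : e \in all_pairs 'I_n ->
  (count (fun A : subgraph n => e \in A.2) copies * n ^ 2 <= #|U| ^ 2 * n ^ #|U|)%N.
Proof.
rewrite /all_pairs inE => /cards2P[a [b [ab ->]]].
pose S (q : U * U) := [set f : {ffun U -> 'I_n} | (f q.1 == a) && (f q.2 == b)].
have cnt : (count (fun A : subgraph n => [set a; b] \in A.2) copies <=
    \sum_(q : U * U | q.1 != q.2) #|S q|)%N.
  rewrite -size_filter.
  apply: (@leq_trans (size (flatten [seq [seq graph_image f | f <- enum (S q)]
     | q <- enum [pred q : U * U | q.1 != q.2]]))); last first.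
    rewrite size_flatten /shape sumnE big_map big_map big_enum/=.
    by apply: leq_sum => q _; rewrite size_map -cardE.
  apply: uniq_leq_size; first exact/filter_uniq/uniq_copies.
  move=> A; rewrite mem_filter => /andP[eA /copies_image[f fi Af]].
  move: eA; rewrite Af => /imsetP[e' e'H abE].
  have /imsetP[u ue fu] : a \in f @: e' by rewrite -abE set21.
  have /imsetP[v ve fv] : b \in f @: e' by rewrite -abE set22.
  apply/flatten_mapP; exists (u, v).
    by rewrite mem_enum inE /=; apply: contraNneq ab => uv; rewrite fu fv uv.
  by apply/mapP; exists f; rewrite // mem_enum inE -fu -fv !eqxx.
apply: leq_trans (leq_mul cnt (leqnn _)) _.
have -> : #|U| ^ 2 * n ^ #|U| = \sum_(q : U * U) n ^ #|U|.
  by rewrite sum_nat_const card_prod mulnn.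
rewrite big_distrl/= big_mkcond.
apply: leq_sum => q _; case: ifP => // quv.
by have := @card_ffun_fix2 U 'I_n q.1 q.2 a b quv; rewrite card_ord => ->.
Qed.

(** Union bound over the edges of [A], one of which an overlapping copy must contain. *)
Lemma count_overlap_copies A : A \in copies ->
  (count (overlap snd A) copies * n ^ 2 <= #|edges H| * (#|U| ^ 2 * n ^ #|U|))%N.
Proof.
move=> AX; rewrite -(copies_card AX) -sum_nat_const.
apply: (@leq_trans (\sum_(e in A.2) count (fun B : subgraph n => e \in B.2) copies * n ^ 2)); last first.
  by apply: leq_sum => e eA; apply: count_copies_edge; apply: (subsetP (copies_sub AX)).
rewrite -big_distrl leq_mul2r; apply/orP; right.
elim: copies => [|B s IH] /=; first by rewrite big1.
rewrite big_split leq_add//=.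
case: (boolP (overlap _ _ _)) => // /pred0Pn[e /andP[/= eA eB]].
by rewrite (bigD1 e)//= eB.
Qed.

(** Every vertex set of size [#|U|] carries a copy, and copies with different vertex sets differ. *)
Lemma bin_le_size_copies : ('C(n, #|U|) <= size copies)%N.
Proof.
rewrite -[n in 'C(n, _)]card_ord -card_draws -(size_map fst) cardE.
apply: uniq_leq_size; first exact: enum_uniq.
move=> S; rewrite mem_enum inE => /eqP cS.
pose f := [ffun u : U => enum_val (cast_ord (esym cS) (enum_rank u))].
have fi : injective f.
  by move=> u v; rewrite !ffunE => /enum_val_inj/cast_ord_inj/enum_rank_inj.
have fS : f @: [set: U] = S.
  apply/eqP; rewrite eqEcard card_imset// cardsT cS leqnn andbT.
  by apply/subsetP => x /imsetP[u _ ->]; rewrite ffunE enum_valP.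
apply/mapP; exists (graph_image f); last by rewrite /= fS.
rewrite mem_enum inE; apply/andP; split; last first.
  by apply/existsP; exists f; rewrite /= !eqxx !andbT; apply/injectiveP.
rewrite /is_subgraph; apply/andP; split.
  apply/subsetP => e /imsetP[e' e'H ->]; rewrite /all_pairs inE card_imset//.
  by move/subsetP: (edges_pairs H) => /(_ _ e'H); rewrite /all_pairs inE.
by apply/forall_inP => e /imsetP[e' _ ->]; apply/imsetS/subsetT.
Qed.

End Copies.

(** Each factor of the falling factorial is at least [n - l], and [n <= 2 * (n - l)]. *)
Lemma expn_le_bin (n l : nat) : (l.*2 <= n)%N -> (n ^ l <= 2 ^ l * l`! * 'C(n, l))%N.
Proof.
move=> ln; rewrite -mulnA [(l`! * _)%N]mulnC bin_ffact.
apply: (@leq_trans ((2 * (n - l)) ^ l)); first by case: l ln => // l ln; rewrite leq_exp2r//; lia.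
rewrite expnMn leq_mul2l; apply/orP; right.
have : forall j, (j <= l)%N -> ((n - l) ^ j <= n ^_ j)%N.
  elim=> // j IH jl; rewrite expnSr ffactnSr leq_mul ?IH ?(ltnW jl)//.
  by apply: leq_sub2l; exact: ltnW.
by apply.
Qed.

End CountingCopies.

(** * Gaussian moments *)

Section GaussianMoments.
Local Open Scope classical_set_scope.
Context {R : realType}.
Local Notation mu := (@lebesgue_measure R).
Local Notation phi := (@normal_pdf R 0 1).

Lemma std_normal_pdfE (x : R) : phi x = normal_peak 1 * expR (- (x ^+ 2 / 2)).
Proof. by rewrite normal_pdfE ?oner_neq0// /normal_fun subr0 expr1n mulNr. Qed.

Lemma is_derive_std_normal_pdf (x : R) : is_derive x (1 : R) phi (- (x * phi x)).
Proof.
have -> : phi = fun x : R => normal_peak 1 * expR (- (x ^+ 2 / 2)).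
  by apply/funext => y; rewrite std_normal_pdfE.
have h : is_derive x (1:R) (fun y : R => - (y ^+ 2 / 2)) (- x).
  apply: is_derive_eq.
  by rewrite /GRing.scale/=; field.
apply: is_derive_eq.
rewrite /GRing.scale/=; ring.
Qed.

(** The boundary term when [x^(j+2) phi] is integrated by parts using [phi' = - x phi]. *)
Definition gauss_primitive (j : nat) (x : R) : R := - (x ^+ j.+1 * phi x).

Lemma is_derive_gauss_primitive (j : nat) (x : R) :
  is_derive x (1 : R) (gauss_primitive j) (x ^+ j.+2 * phi x - j.+1%:R * (x ^+ j * phi x)).
Proof.
have h := is_derive_std_normal_pdf x.
have hX : is_derive x (1 : R) (fun y : R => y ^+ j.+1) (j.+1%:R * x ^+ j).
  have := is_deriveX j.+1 (is_derive_id x (1 : R)).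
  rewrite /GRing.scale/= mulr1 exprfctE; exact.
have hM := is_deriveM hX h.
have hN := is_deriveN hM.
rewrite /gauss_primitive.
apply: (is_derive_eq hN).
rewrite /GRing.scale/= !exprS; ring.
Qed.

Lemma continuous_std_normal_pdf : continuous phi.
Proof. exact/continuous_normal_pdf/oner_neq0. Qed.

Lemma continuous_pow_pdf j : continuous (fun x : R => x ^+ j * phi x).
Proof. by move=> x; apply: cvgM; [exact: exprn_continuous|exact: continuous_std_normal_pdf]. Qed.

Lemma measurable_pow_pdf j (D : set R) : measurable_fun D (fun x : R => x ^+ j * phi x).
Proof. apply: measurable_funTS; apply: measurable_funM; last exact: measurable_normal_pdf.
exact: measurable_funX. Qed.

(** Keeps a single term of the exponential series, [u^(h+1) / (h+1)!] with [u = x^2 / 2]; its degree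
    exceeds that of the polynomial factor by one. *)
Lemma gauss_primitive_bound h (x : R) : 0 < x ->
  `|gauss_primitive h.*2 x| <= (normal_peak 1 * (h.+1)`!%:R * 2 ^+ h.+1) / x.
Proof.
move=> x0; rewrite normrN ger0_norm ?mulr_ge0 ?exprn_ge0 ?(ltW x0) ?normal_pdf_ge0//.
rewrite std_normal_pdfE ler_pdivlMr// expRN.
have e0 : 0 < expR (x ^+ 2 / 2) by exact: expR_gt0.
have := @expR_ge1Dxn R (x ^+ 2 / 2) h.
rewrite divr_ge0 ?sqr_ge0// => /(_ isT) H.
rewrite -[leLHS](_ : (normal_peak 1 * x ^+ h.+1.*2) / expR (x ^+ 2 / 2) = _); last first.
  rewrite doubleS exprS; ring.
rewrite ler_pdivrMr// -!mulrA ler_wpM2l ?normal_peak_ge0//.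
have f0 : 0 < (h.+1)`!%:R :> R by rewrite ltr0n fact_gt0.
have t0 : 0 < 2 ^+ h.+1 :> R by rewrite exprn_gt0.
apply: (@le_trans _ _ ((h.+1)`!%:R * (2 ^+ h.+1 * ((x ^+ 2 / 2) ^+ h.+1 / (h.+1)`!%:R)))).
  rewrite -muln2 mulnC exprM expr_div_n [leRHS](_ : _ = (x ^+ 2) ^+ h.+1)//.
  by field; rewrite !gt_eqF.
rewrite ler_wpM2l ?(ltW f0)// ler_wpM2l ?(ltW t0)//.
by rewrite [x * (x / 2)]mulrA -expr2; apply: le_trans H; rewrite lerDr.
Qed.

Lemma cvg_gauss_primitive h : gauss_primitive h.*2 n%:R @[n --> \oo] --> (0 : R).
Proof.
apply: norm_cvg0.
apply: (@squeeze_cvgr _ _ _ _ (cst 0) (fun n : nat => (normal_peak 1 * (h.+1)`!%:R * 2 ^+ h.+1) * n%:R^-1)).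
- near=> n; rewrite normr_ge0/=; apply: gauss_primitive_bound.
  by rewrite ltr0n; near: n; exact: nbhs_infty_gt.
- exact: cvg_cst.
- rewrite -[X in _ --> X](mulr0 (normal_peak 1 * (h.+1)`!%:R * 2 ^+ h.+1)).
  apply: cvgM; [exact: cvg_cst|apply/gtr0_cvgV0]; last exact: cvgr_idn.
  by near=> n; rewrite ltr0n; near: n; exact: nbhs_infty_gt.
Unshelve. all: end_near. Qed.

Lemma gauss_primitive_odd h (x : R) : gauss_primitive h.*2 (- x) = - gauss_primitive h.*2 x.
Proof.
by rewrite /gauss_primitive !std_normal_pdfE sqrrN exprNn -signr_odd /= odd_double expr1 mulN1r !mulNr.
Qed.

Lemma gauss_moment_itv h (b : R) : 0 < b ->
  \int[mu]_(x in `[- b, b]) (x ^+ h.*2.+2 * phi x) =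
  h.*2.+1%:R * \int[mu]_(x in `[-b, b]) (x ^+ h.*2 * phi x) + 2 * gauss_primitive h.*2 b.
Proof.
move=> b0.
have bb : - b < b by lra.
have int j : mu.-integrable `[- b, b] (EFin \o (fun x => x ^+ j * phi x)).
  apply: continuous_compact_integrable; first exact: segment_compact.
  exact/continuous_subspaceT/continuous_pow_pdf.
have dF x : derivable (gauss_primitive h.*2) x 1.
  by have := is_derive_gauss_primitive h.*2 x => -[].
have cF : continuous (gauss_primitive h.*2).
  by move=> x; apply: differentiable_continuous; apply/derivable1_diffP.
have := @continuous_FTC2 R (fun x => x ^+ h.*2.+2 * phi x - h.*2.+1%:R * (x ^+ h.*2 * phi x)) (gauss_primitive h.*2) _ _ bb.
move=> /(_ _ _ _)/wrap[].
- apply: continuous_subspaceT => x; apply: cvgB; first exact: continuous_pow_pdf.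
  by apply: cvgM; [exact: cvg_cst|exact: continuous_pow_pdf].
- split => //.
  + exact/cvg_at_right_filter/cF.
  + exact/cvg_at_left_filter/cF.
- move=> x _; rewrite derive1E; exact: (@derive_val _ _ _ _ _ _ _ (is_derive_gauss_primitive h.*2 x)).
move=> H.
have : \int[mu]_(x in `[- b, b]) (x ^+ h.*2.+2 * phi x - h.*2.+1%:R * (x ^+ h.*2 * phi x)) = 2 * gauss_primitive h.*2 b.
  rewrite /Rintegral H/= gauss_primitive_odd; ring.
rewrite RintegralB//=; last first.
  apply: continuous_compact_integrable; first exact: segment_compact.
  apply: continuous_subspaceT => x.
  by apply: cvgM; [exact: cvg_cst|exact: continuous_pow_pdf].
rewrite RintegralZl//= => /eqP; rewrite subr_eq => /eqP ->; ring.
Qed.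


(** Monotone convergence on [[-n, n]] applies because even powers are nonnegative. The recursion on
    these intervals passes to the limit as its boundary term vanishes. *)
Lemma gauss_moment h :
  (\int[mu]_x (x ^+ h.*2 * phi x)%:E = (\prod_(i < h) i.*2.+1%:R)%:E)%E.
Proof.
have f0 j x : 0 <= x ^+ j.*2 * phi x.
  by rewrite mulr_ge0 ?normal_pdf_ge0// exprn_even_ge0//= odd_double.
pose I (n : nat) : set R := `[- n%:R, n%:R].
have cvgI j : (\int[mu]_(x in I n) (x ^+ j.*2 * phi x)%:E)%E @[n --> \oo]
    --> (\int[mu]_x (x ^+ j.*2 * phi x)%:E)%E.
  rewrite (_ : [set: R] = \bigcup_n I n); last first.
    apply/esym/seteqP; split => // x _.
    exists (Num.truncn `|x|).+1 => //; rewrite /I /= in_itv/= -ler_norml.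
    by rewrite ltW// truncnS_gt.
  apply: ge0_nondecreasing_set_cvg_integral => //.
  - move=> a b ab; apply/subsetPset => x; rewrite /I /= !in_itv/= -!ler_norml => /le_trans; apply.
    by rewrite ler_nat.
  - by move=> n; exact: measurable_itv.
  - move=> n; apply/measurable_EFinP. exact (@measurable_pow_pdf j.*2 (I n)).
  - by move=> n x _; rewrite lee_fin.
elim: h => [|h IH].
  rewrite big_ord0; under eq_integral do rewrite expr0 mul1r.
  exact: integral_normal_pdf.
have := cvgI h; rewrite IH => /fine_cvg cv1.
apply: (cvg_unique _ (cvgI h.+1)) => //.
rewrite big_ord_recr/= mulrC.
apply: (@cvg_trans _ ((h.*2.+1%:R * \int[mu]_(x in I n) (x ^+ h.*2 * phi x) + 2 * gauss_primitive h.*2 n%:R)%:E @[n --> \oo])).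
  apply: near_eq_cvg; near=> n.
  have n0 : 0 < n%:R :> R by rewrite ltr0n; near: n; exact: nbhs_infty_gt.
  rewrite -gauss_moment_itv// /Rintegral fineK//.
  apply: integrable_fin_num => //=.
  apply: continuous_compact_integrable; first exact: segment_compact.
  exact/continuous_subspaceT/continuous_pow_pdf.
apply: cvg_EFin; first by apply: nearW.
rewrite -[X in _ --> X]addr0; apply: cvgD.
  by apply: cvgM; [exact: cvg_cst|exact: cv1].
rewrite -(mulr0 2); apply: cvgM; [exact: cvg_cst|exact: cvg_gauss_primitive].
Unshelve. all: end_near. Qed.

Lemma even_moment_standard_normal (d : measure_display) (T : measurableType d)
  (Q : probability T R) (N : {RV Q >-> R}) h : standard_normal N ->
  ('E_Q[(fun w => (N w ^+ h.*2)%R)] = (\prod_(i < h) i.*2.+1%:R)%:E)%E.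
Proof.
move=> hN.
have x0 j (x : R) : 0 <= x ^+ j.*2 by rewrite exprn_even_ge0//= odd_double.
have mX j : measurable_fun [set: R] (fun x : R => (x ^+ j)%:E).
  by apply/measurable_EFinP; exact: exprn_measurable.
rewrite -gauss_moment unlock.
pose N' : T -> measurableTypeR R := N.
have mN' : measurable_fun [set: T] N' by exact (measurable_funP N).
transitivity (\int[pushforward Q N']_y (y ^+ h.*2)%:E)%E.
  rewrite ge0_integral_pushforward//=; first exact (mX h.*2).
  by move=> y _; rewrite lee_fin.
transitivity (\int[@normal_prob R 0 1]_x (x ^+ h.*2)%:E)%E.
  by apply: eq_measure_integral => A mA _; exact (hN A mA).
have dom := @normal_prob_dominates R 0 1.
rewrite -(Radon_Nikodym_SigmaFinite.change_of_variables dom)//; last exact (mX h.*2); last first.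
  by move=> y; rewrite lee_fin.
apply: ae_eq_integral => //.
- apply: emeasurable_funM => //; first exact (mX h.*2).
  exact: (measurable_int mu (Radon_Nikodym_SigmaFinite.f_integrable dom)).
- by apply/measurable_EFinP; exact (@measurable_pow_pdf h.*2 [set: R]%classic).
under [X in ae_eq _ _ _ X]eq_fun do rewrite EFinM.
apply: ae_eqe_mul2l => /=.
(* The Radon-Nikodym derivative and [phi] have equal integrals over all measurable sets, hence agree
   almost everywhere. *)
apply: integral_ae_eq => //=.
- exact: (Radon_Nikodym_SigmaFinite.f_integrable dom).
- by apply/measurable_EFinP; exact: measurable_normal_pdf.
- by move=> E E01 mE; rewrite -(Radon_Nikodym_SigmaFinite.f_integral dom).
Qed.

End GaussianMoments.

(** * Moments of subgraph counts *)

Section FiniteExpectation.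
Context (R : realType) (d : measure_display) (T : measurableType d) (P : probability T R).

(** Integrability is bundled with the value so that linearity carries no side conditions. *)
Definition has_mean (f : T -> R) (v : R) : Prop :=
  P.-integrable [set: T]%classic (EFin \o f) /\ (\int[P]_w (f w)%:E = v%:E)%E.

Lemma has_mean_ext f g v : f =1 g -> has_mean f v -> has_mean g v.
Proof. by move=> /funext ->. Qed.

Lemma has_mean_expectation f v : has_mean f v -> ('E_P[f] = v%:E)%E.
Proof. by move=> [_ fv]; rewrite unlock. Qed.

Lemma has_meanD f g u v : has_mean f u -> has_mean g v ->
  has_mean (fun w => f w + g w) (u + v).
Proof.
move=> [fi fu] [gi gv]; split; first by have := integrableD measurableT fi gi.
under eq_integral do rewrite EFinD.
by rewrite integralD//= fu gv.
Qed.

Lemma has_meanZ c f v : has_mean f v -> has_mean (fun w => c * f w) (c * v).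
Proof.
move=> [fi fv]; split; first by have := integrableZl measurableT c fi.
under eq_integral do rewrite EFinM.
by rewrite integralZl//= fv.
Qed.

Lemma has_mean0 : has_mean (fun=> 0) 0.
Proof.
by split; [exact: integrable0|rewrite integral0].
Qed.

Lemma has_mean_sum (I : eqType) (r : seq I) (f : I -> T -> R) (v : I -> R) :
  {in r, forall i, has_mean (f i) (v i)} ->
  has_mean (fun w => \sum_(i <- r) f i w) (\sum_(i <- r) v i).
Proof.
elim: r => [|i r IH] fv.
  rewrite big_nil; apply: has_mean_ext has_mean0 => w; by rewrite big_nil.
rewrite big_cons.
apply: (@has_mean_ext (fun w => f i w + \sum_(j <- r) f j w)).
  by move=> w; rewrite big_cons.
apply: has_meanD; first by apply: fv; rewrite mem_head.
by apply: IH => j jr; apply: fv; rewrite inE jr orbT.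
Qed.

Lemma has_mean_indicator (b : T -> bool) v :
  measurable [set w | b w]%classic -> P [set w | b w]%classic = v%:E ->
  has_mean (fun w => (b w)%:R) v.
Proof.
move=> mb Pb.
have e : (fun w => (b w)%:R) = \1_[set w | b w]%classic :> (T -> R).
  by apply/funext => w; rewrite indicE mem_setE.
rewrite e; split.
  by apply: integrable_indic => //; rewrite Pb ltry.
by rewrite integral_indic// classical_sets.setIT.
Qed.

End FiniteExpectation.

(** * Identification of the algebraic moments with expectations over G(n,p) *)

Section RandomGraph.
Context (R : realType) (p : R) (d : measure_display) (T : measurableType d)
  (P : probability T R) (n : nat) (G : T -> sgraph 'I_n).
Hypothesis hG : erdos_renyi P p G.

Definition edges_present (B : {set {set 'I_n}}) (w : T) : R := (B \subset edges (G w))%:R.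

Lemma has_mean_edges_present (B : {set {set 'I_n}}) : B \subset all_pairs 'I_n ->
  has_mean P (edges_present B) (p ^+ #|B|).
Proof.
case: hG => mE pE indE BD.
have eB : [set w | B \subset edges (G w)]%classic =
    (\bigcap_(e in [set` B]) [set w | e \in edges (G w)])%classic.
  apply/seteqP; split => w /=; first by move=> /subsetP Bw e /Bw.
  by move=> Bw; apply/subsetP => e /Bw.
apply: has_mean_indicator; rewrite eB.
  apply: fin_bigcap_measurable => [|e /= eB']; first exact: finite_finpred.
  apply: mE; exact: (subsetP BD).
rewrite indE//; under eq_bigr => e eB' do rewrite pE ?(subsetP BD e eB')//.
by rewrite prodEFin prodr_const.
Qed.

Lemma edges_presentU B C w : edges_present (B :|: C) w = edges_present B w * edges_present C w.
Proof. by rewrite /edges_present subUset -natrM mulnb. Qed.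

(** Multiplying out the first factor and merging indicators by [edges_presentU] reproduces the
    recursion of [mom]. *)
Lemma has_mean_mom (t : seq (subgraph n)) (B : {set {set 'I_n}}) : B \subset all_pairs 'I_n ->
  all (fun A : subgraph n => A.2 \subset all_pairs 'I_n) t ->
  has_mean P (fun w => edges_present B w * \prod_(A <- t) (edges_present A.2 w - p ^+ #|A.2|))
    (mom snd p t B).
Proof.
elim: t B => [|A t IH] B BD /=.
  move=> _; apply: has_mean_ext (has_mean_edges_present BD) => w.
  by rewrite big_nil mulr1.
move=> /andP[AD tD].
have BAD : B :|: A.2 \subset all_pairs 'I_n by rewrite subUset BD.
have := has_meanD (IH _ BAD tD) (has_meanZ (- p ^+ #|A.2|) (IH _ BD tD)).
rewrite mulNr; apply: has_mean_ext => w; rewrite big_cons edges_presentU.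
by rewrite mulrBl mulrBr mulNr -!mulrA; congr (_ - _); rewrite mulrCA.
Qed.

Context (U : finType) (H : sgraph U).

Lemma has_mean_subgraph_indicator A : A \in copies H n ->
  has_mean P (subgraph_indicator R G A) (p ^+ #|A.2|).
Proof.
move=> AX; apply: has_mean_ext (has_mean_edges_present (copies_sub AX)) => w.
move: AX; rewrite mem_enum inE => /andP[/andP[_ Asub] _].
by rewrite /subgraph_indicator /is_subgraph Asub andbT.
Qed.

Lemma centered_countE w : centered_count P H G w =
  \sum_(A <- copies H n) (edges_present A.2 w - p ^+ #|A.2|).
Proof.
rewrite /copies big_enum /centered_count; apply: eq_bigr => A.
move=> AX; have AX' : A \in copies H n by rewrite mem_enum.
rewrite (has_mean_expectation (has_mean_subgraph_indicator AX'))/=.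
move: AX => /andP[/andP[_ Asub] _].
by rewrite /subgraph_indicator /is_subgraph Asub andbT.
Qed.

Lemma has_mean_centered_countX m :
  has_mean P (fun w => centered_count P H G w ^+ m) (moment_sum snd p (copies H n) m).
Proof.
(* The factor for [set0] is constantly 1; it brings the expanded power into the form of
   [has_mean_mom]. *)
apply: (@has_mean_ext _ _ _ _ (fun w => \sum_(t <- seqs (copies H n) m)
    (edges_present set0 w * \prod_(A <- t) (edges_present A.2 w - p ^+ #|A.2|)))).
  move=> w; rewrite centered_countE /edges_present sub0set.
  elim: m => [|m IH]; first by rewrite big_seq1 big_nil mulr1.
  rewrite sum_seqsS exprS big_distrl; apply: eq_bigr => A _.
  by rewrite -IH big_distrr; apply: eq_bigr => t _; rewrite !mul1r big_cons.
apply: has_mean_sum => t; rewrite mem_seqs => /andP[_ /allP tX].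
apply: has_mean_mom; first exact: sub0set.
by apply/allP => A /tX AX; exact: (copies_sub AX).
Qed.

Lemma variance_centered_count :
  ('V_P[centered_count P H G] = (moment_sum snd p (copies H n) 2)%:E)%E.
Proof.
have E1 : ('E_P[centered_count P H G] = 0%:E)%E.
  have := has_mean_expectation (has_mean_centered_countX 1).
  rewrite /moment_sum sum_seqsS.
  rewrite big1; last by move=> A _; rewrite big_seq1 mom1.
  by move=> <-; congr expectation; apply/funext => w; rewrite expr1.
rewrite /variance covariance.unlock E1 -(has_mean_expectation (has_mean_centered_countX 2)).
by congr expectation; apply/funext => w; rewrite fctE /= subr0 expr2.
Qed.

Lemma expectation_normalized_count h : (0 <= moment_sum snd p (copies H n) 2) ->
  ('E_P[(fun w => (normalized_count P H G w ^+ h.*2)%R)] =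
   (moment_sum snd p (copies H n) h.*2 / moment_sum snd p (copies H n) 2 ^+ h)%:E)%E.
Proof.
move=> s0; rewrite mulrC; apply: has_mean_expectation.
apply: has_mean_ext (has_meanZ _ (has_mean_centered_countX h.*2)) => w.
rewrite /normalized_count variance_centered_count/= expr_div_n mulrC.
by rewrite -[in X in _ = _ / X]mul2n exprM sqr_sqrtr.
Qed.

End RandomGraph.

Theorem mainTheorem8 (R : realType) (p : R) (hp0 : 0 < p) (hp1 : p < 1)
    (m l k : nat) (hm : ~~ odd m) (hk : (1 <= k)%N) :
  exists C1 : R,
  forall (U : finType) (H : sgraph U), #|U| = l -> #|edges H| = k ->
  exists n0 : nat, forall n : nat, (n0 <= n)%N ->
  forall (d : measure_display) (T : measurableType d) (P : probability T R)
    (G : T -> sgraph 'I_n), erdos_renyi P p G ->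
  forall (d' : measure_display) (T' : measurableType d') (Q : probability T' R)
    (N : {RV Q >-> R}), standard_normal N ->
  (`| 'E_P[(fun w => (normalized_count P H G w ^+ m)%R)]
      - 'E_Q[(fun w => (N w ^+ m)%R)] | <= (C1 * (1 / n%:R ^+ 2))%:E)%E.
Proof.
(* Comes from [moment_sum2_ge] with [v = n^2] and at least [n^l / (2^l l!)] copies. *)
pose c : R := (1 - p) * p ^+ k.*2 / (2 ^ l * l`!)%:R ^+ 2.
(* The bound of [moment_recursion_error] for [A = n^l], [B = k l^2 n^l] and [w = n^2], with the
   powers of [n] removed. *)
pose K (h : nat) : R := ((h.*2.+2)`! * (1 + h.*2.+2 * (k * l ^ 2)) ^ h.*2.+2
  * (2 ^ h.*2.+2 * h.*2.+2))%:R.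
(* The threshold gives [2l <= n] for the binomial bound, and [n > 0] even if [l = 0]. *)
exists (moment_error c K m./2) => U H Ul Hk; exists (l.*2).+1 => n n0 d T P G hG d' T' Q N hN.
have ln : (l.*2 <= n)%N by lia.
have np : (0 < n)%N by lia.
pose X := copies H n.
pose M := moment_sum snd p X.
have f0 : 0 < (2 ^ l * l`!)%:R :> R by rewrite ltr0n muln_gt0 expn_gt0 fact_gt0.
have c0 : 0 < c by rewrite !(mulr_gt0, invr_gt0, exprn_gt0)// subr_gt0.
have hs : c * n%:R ^+ l.*2 <= M 2 * n%:R ^+ 2.
  have card_pairs : (#|all_pairs 'I_n| <= n ^ 2)%N.
    by rewrite /all_pairs card_draws card_ord bin2 -mulnn; lia.
  have n20 : (0 < n ^ 2)%N by rewrite expn_gt0 np.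
  have := moment_sum2_ge hp0 hp1 (ed := snd) (Xs := X) n20 card_pairs
    (fun A => @copies_sub _ H n A) (fun A AX => etrans (copies_card AX) Hk).
  rewrite natrX; apply: le_trans.
  rewrite /c -!mulrA ler_wpM2l ?subr_ge0 ?(ltW hp1)// ler_wpM2l ?exprn_ge0 ?(ltW hp0)//.
  rewrite mulrC ler_pdivrMr ?exprn_gt0// -muln2 exprM -exprMn -!natrX -natrM -natrX ler_nat.
  rewrite leq_exp2r// (leq_trans (expn_le_bin ln))// mulnC leq_mul2r -Ul.
  rewrite (leq_trans (bin_le_size_copies H n)) ?orbT//.
  (* Here [k >= 1] is used: without edges the variance would vanish. *)
  by rewrite leq_pmull.
have hM h : `|M h.*2.+2 - (M 2 * M h.*2) *+ h.*2.+1| * (n%:R ^+ 2) ^+ h.+2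
     <= K h * n%:R ^+ (l * h.*2.+2).
  have hB : {in X, forall A, count (overlap snd A) X * n ^ 2 <= k * (l ^ 2 * n ^ l)}%N.
    by move=> A AX; have := count_overlap_copies AX; rewrite Ul Hk.
  have hA : (size X <= n ^ l)%N by rewrite -Ul; exact: size_copies_le.
  have n20 : (0 < n ^ 2)%N by rewrite expn_gt0 np.
  have := moment_recursion_error hp0 hp1 h (uniq_copies H n) hA hB n20.
  rewrite natrX => /le_trans; apply; rewrite /K -natrX -natrM ler_nat.
  have -> : (n ^ l + h.*2.+2 * (k * (l ^ 2 * n ^ l)) =
    (1 + h.*2.+2 * (k * l ^ 2)) * n ^ l)%N by rewrite !mulnA mulnDl mul1n.
  by rewrite expnMn -expnM; lia.
have M0 : M 0%N = 1 by exact: moment_sum0.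
have np' : 0 < n%:R :> R by rewrite ltr0n.
have := normalized_moments_close c0 np' M0 hs hM m./2.
have m2 : m = (m./2).*2 by rewrite even_halfK.
have s0 : 0 <= M 2.
  rewrite -(pmulr_lge0 _ (exprn_gt0 2 np')); apply: le_trans hs.
  by rewrite mulr_ge0 ?exprn_ge0 ?ltW.
rewrite m2 (expectation_normalized_count hG) ?s0//.
rewrite (even_moment_standard_normal _ hN) -m2.
by rewrite -EFinB abse_EFin lee_fin -m2.
Qed.
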